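(* The following identity holds: $$-\frac{3}{16}=\sum_{m\ge 1}\frac{m}{3^{2m+1}}\,\zeta(2m+1)\left(2^{2m-1}-1\right)\left(2^{-2m}-1\right).$$
   Context: $\zeta$ is the Riemann zeta function, $\zeta(s)=\sum_{n\ge1}n^{-s}$ for $\Re(s)>1$. *)

(* Defs.v *)
From Stdlib Require Import Reals.
From Coquelicot Require Import Coquelicot.
Open Scope R_scope.

Definition Cexp (z : C) : C :=
  (exp (fst z) * cos (snd z), exp (fst z) * sin (snd z)).

(* x^s = exp (s ln x) for a positive real x and a complex s. *)
Definition Rpos_Cpow (x : R) (s : C) : C :=
  Cexp (Cmult s (RtoC (ln x))).

(* The Riemann zeta function on the half-plane Re s > 1, as its Dirichlet
   series; the index k stands for n = k + 1.  The sum is taken on real and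
   imaginary parts, [Series] being real-valued.  Outside Re s > 1 the series
   diverges and the value is meaningless: this is not the analytic
   continuation. *)
Definition zeta (s : C) : C :=
  (Series (fun k : nat => fst (Rpos_Cpow (INR (S k)) (Copp s))),
   Series (fun k : nat => snd (Rpos_Cpow (INR (S k)) (Copp s)))).

(* [is_series_from1 a l]: the series a 1 + a 2 + a 3 + ... converges to l. *)
Definition is_series_from1 (a : nat -> C) (l : C) : Prop :=
  is_series (fun k : nat => a (S k)) l.

(* Main.v *)
Require Import Defs.
From Stdlib Require Import Reals Lra Lia.
From Coquelicot Require Import Coquelicot.
Open Scope R_scope.

(** Splitting the product of the two brackets into
    [3/2 - 2^(2m)/2 - 2^(-2m)] turns the series into
    [3/2 S(1/3) - 1/4 S(2/3) - 2 S(1/6)], where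
    [S(x) = sum_(m>=1) m x^(2m+1) zeta(2m+1)].  Expanding zeta and summing over
    [m] first gives, for [0 <= x < 1],
    [S(x) = x^2/4 sum_(n>=1) (1/(n-x)^2 - 1/(n+x)^2)]
    ([weighted_odd_zeta_series]).

    At [x = 1/3, 2/3, 1/6] these sums run over inverse squares in fixed residue
    classes modulo 3 and 6.  Each equals a rational boundary term plus a
    rational multiple of [L = sum_(k>=0) (1/(3k+1)^2 - 1/(3k+2)^2)], because the
    even members of the classes [1] and [2] modulo 3 contribute [-L/4], so that
    the analogous sum over [1] and [5] modulo 6 is [5L/4].  In the combination
    above the multiples of [L] cancel and the boundary terms add up to [-3/16]
    ([combined_pole_series]).  On partial sums the cancellation reads
    [P(2N+1) - P(N) -> 0] for the partial sums [P] of [L], so only the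
    convergence of [L] matters and not its value. *)

(** Statements about real series produce equations in the module [R], whose
    carrier the arithmetic tactics do not recognize. *)
Ltac equality_in_R :=
  match goal with |- @eq _ ?x ?y => change (@eq R x y) end.

(** * Exchange of summations *)

(** The remainder of the inner sums after [M] terms is at most [v n] times the
    remainder of [u], which tends to zero; summing over [n] only multiplies this
    bound by the sum of [v]. *)
Lemma is_series_exchange (a : nat -> nat -> R) (u v : nat -> R) :
  (forall m n, Rabs (a m n) <= u m * v n) ->
  ex_series u -> ex_series v ->
  ex_series (fun n => Series (fun m => a m n)) /\
  is_series (fun m => Series (fun n => a m n))
            (Series (fun n => Series (fun m => a m n))).
Proof.
intros Ha Hu Hv.
assert (Hrow : forall m, ex_series (fun n => a m n)).
{ intros m; apply (ex_series_le (V := R_CompleteNormedModule) _ (fun n => u m * v n)).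
  - intros n; apply Ha.
  - exact (ex_series_scal (u m) v Hv). }
assert (Hcol : forall n, ex_series (fun m => a m n)).
{ intros n; apply (ex_series_le (V := R_CompleteNormedModule) _ (fun m => u m * v n)).
  - intros m; apply Ha.
  - now apply ex_series_scal_r. }
assert (Hshift : forall (w : nat -> R) M, ex_series w -> ex_series (fun k => w (S M + k)%nat)).
{ intros w M Hw; now apply (ex_series_incr_n w (S M)). }
pose (T := fun M => Series (fun k => u (S M + k)%nat)).
assert (Htail : forall M n,
  Rabs (Series (fun m => a m n) - sum_f_R0 (fun m => a m n) M) <= T M * v n).
{ intros M n.
  rewrite (Series_incr_n (fun m => a m n) (S M)); [|lia|apply Hcol]; simpl pred.
  match goal with |- Rabs ?e <= _ =>
    replace e with (Series (fun k => a (S M + k)%nat n)) by ring end.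
  assert (Hdom : ex_series (fun k => u (S M + k)%nat * v n)).
  { apply ex_series_scal_r; now apply Hshift. }
  unfold T; rewrite <- Series_scal_r.
  apply Rle_trans with (Series (fun k => Rabs (a (S M + k)%nat n))).
  - apply Series_Rabs.
    apply (ex_series_le (V := R_CompleteNormedModule) _ (fun k => u (S M + k)%nat * v n)); auto.
    intros k; unfold norm; simpl; unfold abs; simpl; rewrite Rabs_Rabsolu; apply Ha.
  - apply Series_le; auto.
    intros k; split; [apply Rabs_pos|apply Ha]. }
assert (Hout : ex_series (fun n => Series (fun m => a m n))).
{ apply ex_series_ext with
    (fun n => (Series (fun m => a m n) - sum_f_R0 (fun m => a m n) 0) + a 0%nat n).
  { intros n; simpl; ring. }
  apply (ex_series_plus (V := R_NormedModule)); [|apply Hrow].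
  apply (ex_series_le (V := R_CompleteNormedModule) _ (fun n => T 0%nat * v n)).
  - intros n; apply Htail.
  - exact (ex_series_scal (T 0%nat) v Hv). }
split; [exact Hout|].
assert (Hfin : forall M, ex_series (fun n => sum_f_R0 (fun m => a m n) M) /\
   Series (fun n => sum_f_R0 (fun m => a m n) M)
     = sum_f_R0 (fun m => Series (fun n => a m n)) M).
{ induction M as [|M [IH1 IH2]]; simpl.
  - split; [apply Hrow|reflexivity].
  - split.
    + now apply (ex_series_plus (V := R_NormedModule)).
    + now rewrite Series_plus, IH2. }
change (is_lim_seq (sum_n (fun m => Series (fun n => a m n)))
          (Series (fun n => Series (fun m => a m n)))).
assert (Hbound : forall M,
  Rabs (Series (fun n => Series (fun m => a m n))
        - sum_f_R0 (fun m => Series (fun n => a m n)) M) <= T M * Series v).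
{ intros M; destruct (Hfin M) as [H1 H2]; rewrite <- H2, <- Series_minus by assumption.
  assert (Hdom : ex_series (fun n => T M * v n)) by exact (ex_series_scal (T M) v Hv).
  rewrite <- Series_scal_l.
  apply Rle_trans with
    (Series (fun n => Rabs (Series (fun m => a m n) - sum_f_R0 (fun m => a m n) M))).
  - apply Series_Rabs.
    apply (ex_series_le (V := R_CompleteNormedModule) _ (fun n => T M * v n)); auto.
    intros n; unfold norm; simpl; unfold abs; simpl; rewrite Rabs_Rabsolu; apply Htail.
  - apply Series_le; auto.
    intros n; split; [apply Rabs_pos|apply Htail]. }
assert (HT : is_lim_seq T 0).
{ apply is_lim_seq_ext with (fun M => Series u - sum_n u M).
  - intros M; unfold T; rewrite sum_n_Reals, (Series_incr_n u (S M)); [|lia|exact Hu].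
    simpl; ring.
  - replace (Finite 0) with (Finite (Series u - Series u)) by (f_equal; ring).
    apply is_lim_seq_minus'; [apply is_lim_seq_const|].
    exact (Series_correct u Hu). }
set (l := Series (fun n => Series (fun m => a m n))) in *.
apply is_lim_seq_le_le with (fun M => l - T M * Series v) (fun M => l + T M * Series v).
- intros M; rewrite sum_n_Reals; specialize (Hbound M); apply Rabs_le_between in Hbound; lra.
- replace (Finite l) with (Finite (l - 0 * Series v)) by (f_equal; ring).
  apply is_lim_seq_minus'; [apply is_lim_seq_const|].
  apply is_lim_seq_mult'; [exact HT|apply is_lim_seq_const].
- replace (Finite l) with (Finite (l + 0 * Series v)) by (f_equal; ring).
  apply is_lim_seq_plus'; [apply is_lim_seq_const|].
  apply is_lim_seq_mult'; [exact HT|apply is_lim_seq_const].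
Qed.

(** * Elementary series *)

Lemma INR_S_ge_1 n : 1 <= INR (S n).
Proof. rewrite S_INR; pose proof (pos_INR n); lra. Qed.

Lemma is_lim_seq_inv_affine a b :
  0 < a -> 0 <= b -> is_lim_seq (fun n => / (a * INR n + b)) 0.
Proof.
intros Ha Hb.
replace (Finite 0) with (Rbar_inv p_infty) by reflexivity.
apply is_lim_seq_inv; [|discriminate].
apply is_lim_seq_le_p_loc with (fun n => a * INR n).
- exists 0%nat; intros n _; lra.
- replace p_infty with (Rbar_mult a p_infty).
  + apply is_lim_seq_scal_l, is_lim_seq_INR.
  + unfold Rbar_mult; simpl; destruct (Rle_dec 0 a) as [h|h]; [|lra].
    destruct (Rle_lt_or_eq_dec 0 a h); [reflexivity|lra].
Qed.

Lemma is_lim_seq_inv_affine_sqr a b :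
  0 < a -> 0 <= b -> is_lim_seq (fun n => / (a * INR n + b) ^ 2) 0.
Proof.
intros Ha Hb.
apply is_lim_seq_ext with (fun n => / (a * INR n + b) * / (a * INR n + b)).
- intros n; rewrite <- Rinv_mult; f_equal; ring.
- replace (Finite 0) with (Finite (0 * 0)) by (f_equal; ring).
  apply is_lim_seq_mult'; now apply is_lim_seq_inv_affine.
Qed.

(** Comparison with the telescoping series of [2/(n(n+1))]. *)
Lemma ex_series_inv_sqr : ex_series (fun n => / INR (S n) ^ 2).
Proof.
apply (ex_series_le (V := R_CompleteNormedModule) _
         (fun n => 2 * (/ INR (S n) - / INR (S (S n))))).
- intros n; unfold norm; simpl norm; unfold abs; simpl abs.
  pose proof (INR_S_ge_1 n) as H; rewrite (S_INR (S n)).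
  set (x := INR (S n)) in *.
  rewrite Rabs_pos_eq by (apply Rlt_le, Rinv_0_lt_compat, pow_lt; lra).
  replace (2 * (/ x - / (x + 1))) with (/ x ^ 2 + (x - 1) * / (x ^ 2 * (x + 1)))
    by (field; lra).
  assert (0 < / (x ^ 2 * (x + 1)))
    by (apply Rinv_0_lt_compat, Rmult_lt_0_compat; [apply pow_lt|]; lra).
  nra.
- exists 2.
  apply (is_lim_seq_ext (fun N => 2 * (1 - / (1 * INR N + 2))) _ (Finite 2)).
  + intros N; rewrite sum_n_Reals; induction N as [|N IH].
    * simpl; field.
    * rewrite tech5, <- IH, !S_INR; pose proof (pos_INR N); field; lra.
  + replace (Finite 2) with (Rbar_mult 2 (1 - 0)) by (simpl; f_equal; ring).
    apply is_lim_seq_scal_l.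
    apply is_lim_seq_minus'; [apply is_lim_seq_const|apply is_lim_seq_inv_affine; lra].
Qed.

(** The Cauchy square of the geometric series. *)
Lemma is_series_geom_sqr q :
  Rabs q < 1 -> is_series (fun k => INR (S k) * q ^ k) (/ (1 - q) ^ 2).
Proof.
intros Hq.
assert (Habs : ex_series (fun k => Rabs (q ^ k))).
{ apply ex_series_ext with (fun k => Rabs q ^ k); [intros k; apply RPow_abs|].
  apply ex_series_geom; now rewrite Rabs_Rabsolu. }
replace (/ (1 - q) ^ 2) with (/ (1 - q) * / (1 - q))
  by (rewrite <- Rinv_mult; f_equal; ring).
apply is_series_ext with (fun n => sum_f_R0 (fun k => q ^ k * q ^ (n - k)) n).
- intros n; rewrite Rmult_comm, <- sum_cte.
  apply sum_eq; intros i Hi; rewrite <- pow_add; f_equal; lia.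
- apply is_series_mult; auto; now apply is_series_geom.
Qed.

Lemma is_series_weighted_odd_pow y :
  Rabs y < 1 ->
  is_series (fun k => INR (S k) * y ^ (2 * k + 3))
            (/ 4 * y ^ 2 * (/ (1 - y) ^ 2 - / (1 + y) ^ 2)).
Proof.
intros Hy.
assert (Hy2 : Rabs (y ^ 2) < 1).
{ rewrite <- RPow_abs; pose proof (Rabs_pos y); simpl; nra. }
replace (/ 4 * y ^ 2 * (/ (1 - y) ^ 2 - / (1 + y) ^ 2)) with (y ^ 3 * / (1 - y ^ 2) ^ 2).
- apply is_series_ext with (fun k => y ^ 3 * (INR (S k) * (y ^ 2) ^ k)).
  + intros k; rewrite pow_add, pow_mult; equality_in_R; ring.
  + exact (is_series_scal (y ^ 3) _ _ (is_series_geom_sqr _ Hy2)).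
- apply Rabs_def2 in Hy; field.
  repeat split; nra.
Qed.

(** * From zeta values to double poles *)

Lemma Rpos_Cpow_opp_INR x p :
  0 < x -> Rpos_Cpow x (Copp (RtoC (INR p))) = RtoC (/ x ^ p).
Proof.
intros Hx; unfold Rpos_Cpow, Cexp, Cmult, Copp, RtoC; simpl.
replace (- INR p * 0 + - 0 * ln x) with 0 by ring.
replace (- INR p * ln x - - 0 * 0) with (- (INR p * ln x)) by ring.
rewrite cos_0, sin_0, exp_Ropp, Rmult_1_r, Rmult_0_r.
now rewrite <- (Rpower_pow p x Hx).
Qed.

Lemma zeta_INR p :
  zeta (RtoC (INR p)) = RtoC (Series (fun n => / INR (S n) ^ p)).
Proof.
assert (H : forall n, Rpos_Cpow (INR (S n)) (Copp (RtoC (INR p))) = RtoC (/ INR (S n) ^ p)).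
{ intros n; apply Rpos_Cpow_opp_INR; pose proof (INR_S_ge_1 n); lra. }
unfold zeta, RtoC at 3; f_equal.
- apply Series_ext; intros n; now rewrite H.
- rewrite (Series_ext _ (fun n => 0 * 0)); [|intros n; rewrite H; simpl; ring].
  rewrite Series_scal_l; ring.
Qed.

Definition double_poles (x : R) (n : nat) : R :=
  / 4 * x ^ 2 * (/ (INR (S n) - x) ^ 2 - / (INR (S n) + x) ^ 2).

(** Expand zeta and sum over the exponents first; the double series is
    dominated by [(k+1) x^(2k+3) / n^2]. *)
Lemma weighted_odd_zeta_series x :
  0 <= x < 1 ->
  ex_series (double_poles x) /\
  is_series (fun k => INR (S k) * x ^ (2 * k + 3)
                      * Series (fun n => / INR (S n) ^ (2 * k + 3)))
            (Series (double_poles x)).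
Proof.
intros Hx.
pose (a := fun k n => INR (S k) * x ^ (2 * k + 3) * / INR (S n) ^ (2 * k + 3)).
assert (Hinner : forall n, Series (fun k => a k n) = double_poles x n).
{ intros n; pose proof (INR_S_ge_1 n) as Hn; unfold a, double_poles.
  set (N := INR (S n)) in *; apply is_series_unique.
  replace (/ 4 * x ^ 2 * (/ (N - x) ^ 2 - / (N + x) ^ 2)) with
    (/ 4 * (x / N) ^ 2 * (/ (1 - x / N) ^ 2 - / (1 + x / N) ^ 2)) by (field; lra).
  apply is_series_ext with (fun k => INR (S k) * (x / N) ^ (2 * k + 3)).
  - intros k; unfold Rdiv; rewrite Rpow_mult_distr, pow_inv; equality_in_R; ring.
  - apply is_series_weighted_odd_pow.
    assert (0 <= x / N < 1).
    { split; [apply Rdiv_le_0_compat; lra|apply Rlt_div_l; lra]. }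
    rewrite Rabs_pos_eq; lra. }
destruct (is_series_exchange a (fun k => INR (S k) * x ^ (2 * k + 3))
            (fun n => / INR (S n) ^ 2)) as [H1 H2].
- intros k n; unfold a; pose proof (INR_S_ge_1 n) as Hn.
  assert (Hk : 0 <= INR (S k) * x ^ (2 * k + 3))
    by (apply Rmult_le_pos; [apply pos_INR|apply pow_le; lra]).
  rewrite Rabs_pos_eq.
  + apply Rmult_le_compat_l; [exact Hk|].
    apply Rinv_le_contravar; [apply pow_lt; lra|apply Rle_pow; [lra|lia]].
  + apply Rmult_le_pos; [exact Hk|].
    apply Rlt_le, Rinv_0_lt_compat, pow_lt; lra.
- exists (/ 4 * x ^ 2 * (/ (1 - x) ^ 2 - / (1 + x) ^ 2)).
  apply is_series_weighted_odd_pow; rewrite Rabs_pos_eq; lra.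
- apply ex_series_inv_sqr.
- rewrite (Series_ext _ _ Hinner) in H2; split.
  + exact (ex_series_ext _ _ Hinner H1).
  + apply is_series_ext with (2 := H2); intros k; unfold a; now rewrite Series_scal_l.
Qed.

(** * The combination at 1/3, 2/3 and 1/6 *)

Definition L3_term (k : nat) : R := / (3 * INR k + 1) ^ 2 - / (3 * INR k + 2) ^ 2.

(** Comparison with the telescoping series of [1/(3k+1)^2 - 1/(3k+4)^2]. *)
Lemma ex_series_L3 : ex_series L3_term.
Proof.
apply (ex_series_le (V := R_CompleteNormedModule) _
         (fun k => / (3 * INR k + 1) ^ 2 - / (3 * INR (S k) + 1) ^ 2)).
- intros k; unfold norm; simpl norm; unfold abs; simpl abs; unfold L3_term.
  rewrite S_INR; pose proof (pos_INR k) as Hk; set (t := INR k) in *.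
  assert (/ (3 * t + 2) ^ 2 <= / (3 * t + 1) ^ 2)
    by (apply Rinv_le_contravar; [apply pow_lt; lra|apply pow_incr; lra]).
  assert (/ (3 * (t + 1) + 1) ^ 2 <= / (3 * t + 2) ^ 2)
    by (apply Rinv_le_contravar; [apply pow_lt; lra|apply pow_incr; lra]).
  rewrite Rabs_pos_eq; lra.
- exists 1.
  apply (is_lim_seq_ext (fun N => 1 - / (3 * INR N + 4) ^ 2) _ (Finite 1)).
  + intros N; rewrite sum_n_Reals; induction N as [|N IH].
    * simpl; field.
    * rewrite tech5, <- IH, !S_INR; pose proof (pos_INR N); field; lra.
  + replace (Finite 1) with (Finite (1 - 0)) by (f_equal; ring).
    apply is_lim_seq_minus'; [apply is_lim_seq_const|].
    apply is_lim_seq_inv_affine_sqr; lra.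
Qed.

Definition combined_poles (k : nat) : R :=
  3 / 2 * double_poles (1 / 3) k - / 4 * double_poles (2 / 3) k
  - 2 * double_poles (1 / 6) k.

(** In the partial sum of [L3_term] up to [2N+1], the terms with even
    denominators are quarters of the terms up to [N] with opposite sign, and the
    terms with odd denominators are those produced by [x = 1/6].  The poles at
    [1/3] and [2/3] give the partial sum up to [N] with shifted indices, hence
    the boundary terms. *)
Lemma sum_combined_poles N :
  sum_f_R0 combined_poles N =
  - (3 / 16) - 3 / 8 * / (3 * INR N + 4) ^ 2 + / 4 * / (3 * INR N + 5) ^ 2
  + / 2 * / (6 * INR N + 7) ^ 2
  + / 2 * (sum_f_R0 L3_term (2 * N + 1) - sum_f_R0 L3_term N).
Proof.
assert (Hterm : forall k, combined_poles k =
  3 / 8 * (/ (3 * INR k + 2) ^ 2 - / (3 * INR k + 4) ^ 2)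
  - / 4 * (/ (3 * INR k + 1) ^ 2 - / (3 * INR k + 5) ^ 2)
  - / 2 * (/ (6 * INR k + 5) ^ 2 - / (6 * INR k + 7) ^ 2)).
{ intros k; unfold combined_poles, double_poles; rewrite S_INR.
  pose proof (pos_INR k); set (t := INR k) in *.
  replace (t + 1 - 1 / 3) with ((3 * t + 2) / 3) by field.
  replace (t + 1 + 1 / 3) with ((3 * t + 4) / 3) by field.
  replace (t + 1 - 2 / 3) with ((3 * t + 1) / 3) by field.
  replace (t + 1 + 2 / 3) with ((3 * t + 5) / 3) by field.
  replace (t + 1 - 1 / 6) with ((6 * t + 5) / 6) by field.
  replace (t + 1 + 1 / 6) with ((6 * t + 7) / 6) by field.
  unfold Rdiv; rewrite !Rpow_mult_distr, !Rinv_mult, !pow_inv, !Rinv_inv; field; lra. }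
induction N as [|N IH].
- rewrite Nat.mul_0_r; simpl sum_f_R0; rewrite Hterm; unfold L3_term; simpl; field.
- replace (2 * S N + 1)%nat with (S (S (2 * N + 1))) by lia.
  rewrite !tech5, IH, Hterm; unfold L3_term.
  rewrite !S_INR, plus_INR, mult_INR; change (INR 2) with 2; change (INR 1) with 1.
  pose proof (pos_INR N); set (t := INR N) in *.
  replace (3 * (2 * t + 1 + 1) + 1) with (6 * t + 7) by ring.
  replace (3 * (2 * t + 1 + 1) + 2) with (2 * (3 * t + 4)) by ring.
  replace (3 * (2 * t + 1 + 1 + 1) + 1) with (2 * (3 * t + 5)) by ring.
  replace (3 * (2 * t + 1 + 1 + 1) + 2) with (6 * t + 11) by ring.
  replace (3 * (t + 1) + 1) with (3 * t + 4) by ring.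
  replace (3 * (t + 1) + 2) with (3 * t + 5) by ring.
  replace (6 * (t + 1) + 5) with (6 * t + 11) by ring.
  rewrite !(Rpow_mult_distr 2), !Rinv_mult.
  replace (/ 2 ^ 2) with (/ 4) by field.
  lra.
Qed.

Lemma combined_pole_series : is_series combined_poles (- (3 / 16)).
Proof.
destruct ex_series_L3 as [L HL].
assert (HP : is_lim_seq (sum_f_R0 L3_term) L).
{ apply is_lim_seq_ext with (sum_n L3_term); [intros n; apply sum_n_Reals|exact HL]. }
apply (is_lim_seq_ext (sum_f_R0 combined_poles) _ (Finite (- (3 / 16)))).
{ intros N; symmetry; apply sum_n_Reals. }
eapply is_lim_seq_ext; [intros N; symmetry; apply sum_combined_poles|].
replace (Finite (- (3 / 16))) with
  (Finite (- (3 / 16) - 3 / 8 * 0 + / 4 * 0 + / 2 * 0 + / 2 * (L - L)))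
  by (f_equal; lra).
assert (Hc : forall c a b, 0 < a -> 0 <= b ->
  is_lim_seq (fun N => c * / (a * INR N + b) ^ 2) (c * 0)).
{ intros c a b Ha Hb; apply is_lim_seq_mult'; [apply is_lim_seq_const|].
  now apply is_lim_seq_inv_affine_sqr. }
do 3 try apply is_lim_seq_plus'.
- apply is_lim_seq_minus'; [apply is_lim_seq_const|apply Hc; lra].
- apply Hc; lra.
- apply Hc; lra.
- apply is_lim_seq_mult'; [apply is_lim_seq_const|].
  apply is_lim_seq_minus'; [|exact HP].
  apply (is_lim_seq_subseq (sum_f_R0 L3_term) L (fun N => 2 * N + 1)%nat); [|exact HP].
  apply eventually_subseq; intros n; lia.
Qed.

(** * The identity *)

Lemma is_series_RtoC (a : nat -> R) (l : R) :
  is_series a l ->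
  is_series (K := C_AbsRing) (V := C_NormedModule) (fun n => RtoC (a n)) (RtoC l).
Proof.
intros H.
assert (Hsum : forall N, RtoC (sum_n a N)
  = sum_n (G := C_NormedModule) (fun n => RtoC (a n)) N).
{ induction N as [|N IH].
  - now rewrite !sum_O.
  - rewrite !sum_Sn, <- IH; unfold plus; simpl; apply RtoC_plus. }
unfold is_series.
apply (filterlim_ext (fun N => RtoC (sum_n a N))); [exact Hsum|].
apply filterlim_comp with (1 := H).
intros P [eps HP]; exists eps; intros y Hy; apply HP.
split; [exact Hy|apply ball_center].
Qed.

Lemma is_series_lincomb3 (p q r : R) (a b c : nat -> R) (la lb lc : R) :
  is_series a la -> is_series b lb -> is_series c lc ->
  is_series (fun n => p * a n - q * b n - r * c n) (p * la - q * lb - r * lc).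
Proof.
intros Ha Hb Hc.
exact (is_series_minus _ _ _ _
  (is_series_minus _ _ _ _ (is_series_scal p _ _ Ha) (is_series_scal q _ _ Hb))
  (is_series_scal r _ _ Hc)).
Qed.

(** The exponents are those of the index [m = k + 1]. *)
Lemma split_brackets (i Z : R) (k : nat) :
  i / 3 ^ (2 * k + 3) * Z * (2 ^ (2 * k + 1) - 1) * (/ 2 ^ (2 * k + 2) - 1) =
  3 / 2 * (i * (1 / 3) ^ (2 * k + 3) * Z) - / 4 * (i * (2 / 3) ^ (2 * k + 3) * Z)
  - 2 * (i * (1 / 6) ^ (2 * k + 3) * Z).
Proof.
replace (1 / 6) with (/ 3 * / 2) by field.
unfold Rdiv; rewrite !Rpow_mult_distr, !pow_inv, pow1, !pow_add.
assert (2 ^ (2 * k) <> 0) by (apply pow_nonzero; lra).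
assert (3 ^ (2 * k) <> 0) by (apply pow_nonzero; lra).
field; auto.
Qed.

Theorem mainTheorem8 :
  is_series_from1
    (fun m : nat =>
       (RtoC (INR m / 3 ^ (2 * m + 1))
        * zeta (RtoC (INR (2 * m + 1)))
        * RtoC (2 ^ (2 * m - 1) - 1)
        * RtoC (/ 2 ^ (2 * m) - 1))%C)
    (RtoC (- (3 / 16))).
Proof.
destruct (weighted_odd_zeta_series (1 / 3)) as [E1 S1]; [lra|].
destruct (weighted_odd_zeta_series (2 / 3)) as [E2 S2]; [lra|].
destruct (weighted_odd_zeta_series (1 / 6)) as [E3 S3]; [lra|].
pose proof (is_series_lincomb3 (3 / 2) (/ 4) 2 _ _ _ _ _ _ S1 S2 S3) as Hsum.
pose proof (is_series_lincomb3 (3 / 2) (/ 4) 2 _ _ _ _ _ _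
  (Series_correct _ E1) (Series_correct _ E2) (Series_correct _ E3)) as Hpoles.
rewrite (eq_trans (eq_sym (is_series_unique _ _ Hpoles))
                  (is_series_unique _ _ combined_pole_series)) in Hsum.
apply is_series_ext with (2 := is_series_RtoC _ _ Hsum).
intros k; rewrite zeta_INR, <- !RtoC_mult; apply f_equal; symmetry.
replace (2 * S k + 1)%nat with (2 * k + 3)%nat by lia.
replace (2 * S k - 1)%nat with (2 * k + 1)%nat by lia.
replace (2 * S k)%nat with (2 * k + 2)%nat by lia.
apply split_brackets.
Qed.
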